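(* Let $L$ be the length of a closed linear trajectory in the double pentagon with direction in the 3rd sector, and let $(c,d,e,f)$ be the vector whose components are the numbers of symbols ${\rm I},{\rm II},{\rm III},{\rm IV}$ in its Roman cyclic symbolic orbit. Then the billiard trajectory in the regular pentagon starting from the same point in the same direction is also periodic, and its length is $$\begin{cases} L, & \text{if } (c-f)+2(e-d)\equiv 0 \bmod 5,\\ 5L, & \text{if } (c-f)+2(e-d)\not\equiv 0 \bmod 5.\end{cases}$$
   Context: Let $P$ be a regular plane pentagon of side $1$ with a horizontal side at the bottom; label its sides, counterclockwise starting from the bottom side, by $3,5,2,4,1$. Let $P'=-P$ be its centrally symmetric copy; the side of $P'$ parallel to side $i$ of $P$ is also labelled $i$. The double pentagon $X$ is the flat surface obtained from $P\sqcup P'$ by gluing, for each $i$, the two sides labelled $i$ by a parallel translation. The 3rd sector is the set of directions (modulo $180^\circ$) making an angle $\theta$ with the horizontal (counterclockwise) such that $72^\circ\le\theta\le108^\circ$. The symbolic orbit of a closed trajectory on $X$ (avoiding the vertices) is the word in $1,\dots,5$ formed by the labels of the sides consecutively crossed in one traversal, considered up to cyclic permutation. For a direction in the 3rd sector it splits into consecutive two-letter blocks, each being one of $43,41,25,23$; replacing $43\to{\rm I}$, $41\to{\rm II}$, $25\to{\rm III}$, $23\to{\rm IV}$ gives the Roman cyclic symbolic orbit. The billiard trajectory in the regular pentagon is the billiard trajectory in $P$ (reflecting in the sides of $P$ by the law of equal angles) starting at the point of $P$ and in the direction of the given closed trajectory of $X$. Periodic billiard orbits are always understood to be even-periodic: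 the length of a periodic billiard trajectory is the length travelled until the first return to the initial point and direction after an even number of reflections (so that it is included in a family of parallel periodic trajectories of the same length). *)

(* Defs.v *)
From Stdlib Require Import Reals ZArith Arith List.
From Coquelicot Require Import Coquelicot.
Open Scope R_scope.

(* The plane is identified with the complex numbers [C] (= R * R). *)
Definition unit_dir (theta : R) : C := (cos theta, sin theta).

Definition cross (a b : C) : R := Re a * Im b - Im a * Re b.

Inductive label := L1 | L2 | L3 | L4 | L5.

(* Position of a side counterclockwise from the bottom one: 3, 5, 2, 4, 1. *)
Definition pos (i : label) : nat :=
  match i with L3 => 0 | L5 => 1 | L2 => 2 | L4 => 3 | L1 => 4 end.

(* Vertices of the regular pentagon of side 1 centred at the origin, in
   counterclockwise order: circumradius 1 / (2 sin 36deg), and the bottom side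
   joins vertex 0 (at angle -126deg) to vertex 1 (at angle -54deg). *)
Definition vertex (k : nat) : C :=
  (RtoC (/ (2 * sin (PI / 5))) *
   unit_dir (- (7 * PI / 10) + INR k * (2 * PI / 5)))%C.

Definition src (i : label) : C := vertex (pos i).
Definition tgt (i : label) : C := vertex (S (pos i)).
Definition edge (i : label) : C := (tgt i - src i)%C.

(* The closed pentagon P with its five vertices removed, since trajectories
   avoid them.  A vertex is an extreme point of the (convex) pentagon, so the
   segment between two points of [pentagon] stays in [pentagon]. *)
Definition pentagon (x : C) : Prop :=
  forall i, 0 <= cross (edge i) (x - src i)%C /\ x <> src i.

Definition open_side (i : label) (x : C) : Prop :=
  exists s, 0 < s < 1 /\ x = (RtoC (1 - s) * src i + RtoC s * tgt i)%C.

(* Sides are oriented counterclockwise, so P lies to the left of [edge i]. *)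
Definition outward (i : label) (v : C) : Prop := cross (edge i) v < 0.

Inductive sheet := SheetP | SheetP'.

Definition other (s : sheet) : sheet :=
  match s with SheetP => SheetP' | SheetP' => SheetP end.

(* Since P' = -P, membership in P', in its sides, and the outward condition
   are obtained from those of P through [z |-> -z]. *)
Definition flip (s : sheet) (z : C) : C :=
  match s with SheetP => z | SheetP' => (- z)%C end.

(* The translation gluing side [i] of a sheet to side [i] of the other one; for
   SheetP it sends [src i] to [- tgt i] and [tgt i] to [- src i]. *)
Definition glue (s : sheet) (i : label) (x : C) : C :=
  match s with
  | SheetP => (x - (src i + tgt i))%C
  | SheetP' => (x + (src i + tgt i))%C
  end.

(* [flow v p t w q]: moving on the double pentagon from [p] in the direction [v]
   (at speed |v|) for time [t] leads to [q], the sides crossed being [w]. *)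
Inductive flow (v : C) : sheet * C -> R -> list label -> sheet * C -> Prop :=
| flow_stay (s : sheet) (x : C) (t : R) :
    0 <= t ->
    pentagon (flip s x) -> pentagon (flip s (x + RtoC t * v)%C) ->
    flow v (s, x) t nil (s, (x + RtoC t * v)%C)
| flow_cross (s : sheet) (x : C) (t : R) (i : label)
    (t' : R) (w : list label) (q : sheet * C) :
    0 <= t ->
    pentagon (flip s x) ->
    open_side i (flip s (x + RtoC t * v)%C) -> outward i (flip s v) ->
    flow v (other s, glue s i (x + RtoC t * v)%C) t' w q ->
    flow v (s, x) (t + t') (i :: w) q.

(* For a unit vector [v]: the trajectory from [p] in the direction [v] closes up
   for the first time after length [L], having crossed [w] in this traversal. *)
Definition closed_trajectory
    (v : C) (p : sheet * C) (L : R) (w : list label) : Prop :=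
  0 < L /\ flow v p L w p /\
  (forall L' w', 0 < L' -> flow v p L' w' p -> L <= L').

(* Reflection of a velocity in the line spanned by the unit vector [edge i]. *)
Definition reflect (i : label) (v : C) : C := (edge i * edge i * Cconj v)%C.

(* [billiard (x, v) t n (y, u)]: the billiard trajectory from [x] with velocity
   [v] is at [y] with velocity [u] at time [t], after [n] reflections. *)
Inductive billiard : C * C -> R -> nat -> C * C -> Prop :=
| billiard_stay (x v : C) (t : R) :
    0 <= t ->
    pentagon x -> pentagon (x + RtoC t * v)%C ->
    billiard (x, v) t 0 ((x + RtoC t * v)%C, v)
| billiard_bounce (x v : C) (t : R) (i : label) (t' : R) (n : nat) (q : C * C) :
    0 <= t ->
    pentagon x ->
    open_side i (x + RtoC t * v)%C -> outward i v ->
    billiard ((x + RtoC t * v)%C, reflect i v) t' n q ->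
    billiard (x, v) (t + t') (S n) q.

Definition billiard_return (x v : C) (T : R) : Prop :=
  0 < T /\ exists n, Nat.Even n /\ billiard (x, v) T n (x, v).

Definition billiard_periodic (x v : C) : Prop := exists T, billiard_return x v T.

Definition billiard_length (x v : C) (T : R) : Prop :=
  billiard_return x v T /\ (forall T', billiard_return x v T' -> T <= T').

(* Directions of the sector are taken modulo 180deg. *)
Definition in_sector3 (v : C) : Prop :=
  exists theta, 2 * PI / 5 <= theta <= 3 * PI / 5 /\
    (v = unit_dir theta \/ v = (- unit_dir theta)%C).

Inductive roman := RI | RII | RIII | RIV.

Definition roman_eq_dec (a b : roman) : {a = b} + {a <> b}.
Proof. decide equality. Defined.

Definition block (a : roman) : list label :=
  match a with
  | RI => L4 :: L3 :: nil
  | RII => L4 :: L1 :: nil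
  | RIII => L2 :: L5 :: nil
  | RIV => L2 :: L3 :: nil
  end.

(* The blocks 43, 41, 25, 23 are those met when the trajectory is run upwards
   (from 72deg to 108deg), so the word of a trajectory run downwards is first
   reversed. *)
Definition upward_word (v : C) (w : list label) : list label :=
  if Rlt_dec 0 (Im v) then w else rev w.

Definition cyclic_perm {A : Type} (u w : list A) : Prop :=
  exists w1 w2, w = w1 ++ w2 /\ u = w2 ++ w1.

Definition roman_orbit (v : C) (w : list label) (rho : list roman) : Prop :=
  cyclic_perm (flat_map block rho) (upward_word v w).

Definition nb (a : roman) (rho : list roman) : Z :=
  Z.of_nat (count_occ roman_eq_dec rho a).

(* Main.v *)
Require Import Defs.
From Stdlib Require Import Reals ZArith List Lia Lra.
From Coquelicot Require Import Coquelicot.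
Import ListNotations.
Open Scope R_scope.

(** The billiard trajectory is obtained from the trajectory on the double
    pentagon by folding.  Let [axial i] be the symmetry of the pentagon that
    preserves side [i].  When the trajectory on the surface leaves P through
    side [i], the gluing, then the point reflection [z |-> -z] that takes P' to P,
    then [axial i], together act on the points of that side as the identity and
    on velocities as the billiard reflection.  Hence after crossing
    [w = i1 ... in] the billiard is the image of the surface trajectory under
    the symmetry [unfold_map w], the composite of the [axial ik]
    ([flow_billiard]), and conversely every billiard trajectory lifts to the
    surface ([billiard_flow]).

    Two axial symmetries compose to a rotation, so for a word of even length
    [unfold_map w] is the rotation by 2 * 72 degrees times the alternating sum
    of the positions of the sides of [w] ([unfold_map_rotation]).  It fixes a
    nonzero velocity only if this sum is 0 mod 5, and then it is the identity.
    So the even billiard returns are exactly the returns of the surface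
    trajectory whose word has alternating sum 0 mod 5 ([billiard_return_flow]).

    Since the flow is deterministic, the returns on the surface happen at the
    multiples [m * L], with word [w] repeated [m] times
    ([closed_flow_multiple]) and alternating sum [m] times that of [w].  As 5 is
    prime, the first admissible [m] is 1 if the sum of [w] is 0 mod 5 and 5
    otherwise.  Finally the blocks 43, 41, 25, 23 have alternating sums
    3, -1, 1, 2, whose doubles are 1, -2, 2, -1 mod 5, and passing to a cyclic
    permutation or to the reversed word changes at most the sign of the sum
    ([alt_sum_roman_orbit]): the condition is [(c - f) + 2 (e - d) = 0 mod 5]. *)

(** * Plane vectors and fifth roots of unity *)

Lemma unit_dir_add (a b : R) : unit_dir (a + b) = (unit_dir a * unit_dir b)%C.
Proof.
  unfold unit_dir; rewrite cos_plus, sin_plus.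
  apply injective_projections; simpl; ring.
Qed.

Lemma unit_dir_conj (a : R) : Cconj (unit_dir a) = unit_dir (- a).
Proof. unfold unit_dir; rewrite cos_neg, sin_neg; reflexivity. Qed.

Lemma unit_dir_PI : unit_dir PI = (- RtoC 1)%C.
Proof.
  unfold unit_dir; rewrite cos_PI, sin_PI.
  apply injective_projections; simpl; ring.
Qed.

Lemma unit_dir_neq_0 (a : R) : unit_dir a <> RtoC 0.
Proof.
  intros E. injection E as Ec Es.
  generalize (sin2_cos2 a). rewrite Ec, Es. unfold Rsqr. lra.
Qed.

Lemma cross_unit_dir (a b : R) : cross (unit_dir a) (unit_dir b) = sin (b - a).
Proof. unfold cross, unit_dir, Re, Im; simpl. rewrite sin_minus. ring. Qed.

Lemma cross_minus_r (a b c : C) : cross a (b - c)%C = cross a b - cross a c.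
Proof. unfold cross, Re, Im; simpl; ring. Qed.

Lemma cross_plus_r (a b c : C) : cross a (b + c)%C = cross a b + cross a c.
Proof. unfold cross, Re, Im; simpl; ring. Qed.

Lemma cross_scal_r (r : R) (a b : C) : cross a (RtoC r * b)%C = r * cross a b.
Proof. unfold cross, Re, Im; simpl; ring. Qed.

Lemma cross_self (a : C) : cross a a = 0.
Proof. unfold cross; ring. Qed.

Definition zeta (k : Z) : C := unit_dir (IZR k * (2 * PI / 5)).

Lemma zeta_0 : zeta 0 = RtoC 1.
Proof.
  unfold zeta, unit_dir. rewrite Rmult_0_l, cos_0, sin_0. reflexivity.
Qed.

Lemma zeta_add (j k : Z) : zeta (j + k) = (zeta j * zeta k)%C.
Proof.
  unfold zeta. rewrite plus_IZR, Rmult_plus_distr_r. apply unit_dir_add.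
Qed.

Lemma zeta_opp (k : Z) : Cconj (zeta k) = zeta (- k).
Proof.
  unfold zeta. rewrite unit_dir_conj, opp_IZR. f_equal. ring.
Qed.

Lemma zeta_conj_mul (k : Z) : (zeta k * Cconj (zeta k))%C = RtoC 1.
Proof. rewrite zeta_opp, <- zeta_add, Z.add_opp_diag_r. apply zeta_0. Qed.

Lemma zeta_5 : zeta 5 = RtoC 1.
Proof.
  unfold zeta, unit_dir.
  replace (5 * (2 * PI / 5)) with (2 * PI) by field.
  rewrite cos_2PI, sin_2PI. reflexivity.
Qed.

Lemma zeta_mul_5 (k : Z) : zeta (5 * k) = RtoC 1.
Proof.
  assert (N : forall n : nat, zeta (5 * Z.of_nat n) = RtoC 1).
  { induction n as [|n IH].
    - apply zeta_0.
    - rewrite Nat2Z.inj_succ.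
      replace (5 * Z.succ (Z.of_nat n))%Z with (5 + 5 * Z.of_nat n)%Z by lia.
      rewrite zeta_add, zeta_5, IH. ring. }
  destruct (Z_le_gt_dec 0 k) as [P | P].
  - rewrite <- (Z2Nat.id k) by exact P. apply N.
  - replace (5 * k)%Z with (- (5 * Z.of_nat (Z.to_nat (- k))))%Z by lia.
    rewrite <- zeta_opp, N.
    apply injective_projections; simpl; ring.
Qed.

Lemma zeta_mod (k : Z) : zeta (k mod 5) = zeta k.
Proof.
  rewrite (Z_div_mod_eq_full k 5) at 2.
  rewrite zeta_add, zeta_mul_5. ring.
Qed.

(** For the residues 1, 2 the imaginary part is positive, for 3, 4 negative. *)
Lemma zeta_eq_1 (k : Z) : zeta k = RtoC 1 -> (k mod 5 = 0)%Z.
Proof.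
  rewrite <- zeta_mod. intros E.
  pose proof (Z.mod_pos_bound k 5 ltac:(lia)) as B.
  pose proof PI_RGT_0 as P.
  injection E as Ec Es.
  destruct (Z.eq_dec (k mod 5) 0) as [|N]; [assumption|exfalso].
  assert (C : (k mod 5 = 1 \/ k mod 5 = 2 \/ k mod 5 = 3 \/ k mod 5 = 4)%Z) by lia.
  destruct C as [C|[C|[C|C]]]; rewrite C in Es.
  - generalize (sin_gt_0 (1 * (2 * PI / 5)) ltac:(lra) ltac:(lra)). lra.
  - generalize (sin_gt_0 (2 * (2 * PI / 5)) ltac:(lra) ltac:(lra)). lra.
  - generalize (sin_lt_0 (3 * (2 * PI / 5)) ltac:(lra) ltac:(lra)). lra.
  - generalize (sin_lt_0 (4 * (2 * PI / 5)) ltac:(lra) ltac:(lra)). lra.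
Qed.

(** * The vertices, sides and heights of the pentagon *)

(** The vertices with indices in the integers, hence 5-periodic: the images of
    vertices under the symmetries are then given by affine index formulas. *)
Definition corner (k : Z) : C :=
  (RtoC (/ (2 * sin (PI / 5))) *
   unit_dir (- (7 * PI / 10) + IZR k * (2 * PI / 5)))%C.

Lemma corner_zeta (k : Z) : corner k = (zeta k * corner 0)%C.
Proof.
  unfold corner, zeta. rewrite Rmult_0_l, Rplus_0_r, unit_dir_add. ring.
Qed.

Lemma corner_mod (k : Z) : corner (k mod 5) = corner k.
Proof. rewrite corner_zeta, zeta_mod, <- corner_zeta. reflexivity. Qed.

Lemma corner_vertex (k : nat) : vertex k = corner (Z.of_nat k).
Proof. unfold vertex, corner. rewrite INR_IZR_INZ. reflexivity. Qed.

Lemma sin_36_pos : 0 < sin (PI / 5).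
Proof. pose proof PI_RGT_0. apply sin_gt_0; lra. Qed.

(** The circumradius [1 / (2 sin 36deg)] makes the sides unit vectors: by the
    sum-to-product formulas the chord between the angles [a] and [a + 72deg] has
    length [2 sin 36deg] on the unit circle and direction [a + 126deg]. *)
Lemma corner_succ (k : Z) : (corner (k + 1) - corner k)%C = zeta k.
Proof.
  pose proof sin_36_pos as P.
  unfold corner, zeta, unit_dir.
  set (a := IZR k * (2 * PI / 5)).
  assert (Ea : - (7 * PI / 10) + IZR (k + 1) * (2 * PI / 5)
    = - (7 * PI / 10) + a + 2 * PI / 5) by (unfold a; rewrite plus_IZR; ring).
  rewrite Ea.
  pose proof (form2 (- (7 * PI / 10) + a + 2 * PI / 5) (- (7 * PI / 10) + a)) as Hc.
  pose proof (form4 (- (7 * PI / 10) + a + 2 * PI / 5) (- (7 * PI / 10) + a)) as Hs.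
  replace ((- (7 * PI / 10) + a + 2 * PI / 5 - (- (7 * PI / 10) + a)) / 2)
    with (PI / 5) in Hc, Hs by field.
  replace ((- (7 * PI / 10) + a + 2 * PI / 5 + (- (7 * PI / 10) + a)) / 2)
    with (a - PI / 2) in Hc, Hs by field.
  rewrite sin_minus, sin_PI2, cos_PI2 in Hc.
  rewrite cos_minus, sin_PI2, cos_PI2 in Hs.
  set (r := / (2 * sin (PI / 5))).
  assert (Hr : r * (2 * sin (PI / 5)) = 1) by (unfold r; field; lra).
  apply injective_projections; simpl.
  - transitivity (r * (cos (- (7 * PI / 10) + a + 2 * PI / 5)
                       - cos (- (7 * PI / 10) + a))); [ring|].
    rewrite Hc. transitivity (r * (2 * sin (PI / 5)) * cos a); [ring|].
    rewrite Hr; ring.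
  - transitivity (r * (sin (- (7 * PI / 10) + a + 2 * PI / 5)
                       - sin (- (7 * PI / 10) + a))); [ring|].
    rewrite Hs. transitivity (r * (2 * sin (PI / 5)) * sin a); [ring|].
    rewrite Hr; ring.
Qed.

(** The height of vertex [j + d] over side [j]; the factors show its sign: it
    vanishes for the two ends [d = 0, 1] of the side and is positive for the three
    other vertices. *)
Lemma height_formula (j d : Z) :
  cross (zeta j) (corner (j + d) - corner j)%C
  = / sin (PI / 5) * (sin (IZR d * (PI / 5)) * sin (IZR (d - 1) * (PI / 5))).
Proof.
  pose proof sin_36_pos as P.
  rewrite cross_minus_r. unfold corner, zeta.
  rewrite !cross_scal_r, !cross_unit_dir, plus_IZR, minus_IZR, <- Rmult_minus_distr_l.
  rewrite form4.
  match goal with |- context [cos ?x] =>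
    replace x with ((IZR d - 1) * (PI / 5) - PI / 2) by field end.
  match goal with |- context [sin (?x / 2)] =>
    replace (x / 2) with (IZR d * (PI / 5)) by field end.
  rewrite cos_minus, sin_PI2, cos_PI2.
  field. lra.
Qed.

Lemma sin_36_mul_nonneg (d : Z) : (0 <= d <= 5)%Z -> 0 <= sin (IZR d * (PI / 5)).
Proof.
  intros [A B]. apply IZR_le in A, B. pose proof PI_RGT_0.
  apply sin_ge_0; nra.
Qed.

Lemma sin_36_mul_pos (d : Z) : (0 < d < 5)%Z -> 0 < sin (IZR d * (PI / 5)).
Proof.
  intros [A B]. apply IZR_lt in A, B. pose proof PI_RGT_0.
  apply sin_gt_0; nra.
Qed.

Lemma height_nonneg (j d : Z) : (0 <= d <= 5)%Z ->
  0 <= cross (zeta j) (corner (j + d) - corner j)%C.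
Proof.
  intros B. rewrite height_formula.
  pose proof (Rinv_0_lt_compat _ sin_36_pos) as P.
  apply Rmult_le_pos; [lra|].
  destruct (Z.eq_dec d 0) as [->|N].
  - rewrite Rmult_0_l, sin_0. lra.
  - apply Rmult_le_pos; apply sin_36_mul_nonneg; lia.
Qed.

Lemma height_pos (j d : Z) : (2 <= d <= 4)%Z ->
  0 < cross (zeta j) (corner (j + d) - corner j)%C.
Proof.
  intros B. rewrite height_formula.
  apply Rmult_lt_0_compat; [apply Rinv_0_lt_compat, sin_36_pos|].
  apply Rmult_lt_0_compat; apply sin_36_mul_pos; lia.
Qed.

Definition zpos (i : label) : Z := Z.of_nat (Defs.pos i).

(** The inverse of [zpos] modulo 5. *)
Definition side_at (k : Z) : label :=
  match (k mod 5)%Z with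
  | 0 => L3 | 1 => L5 | 2 => L2 | 3 => L4 | _ => L1
  end%Z.

Lemma zpos_side_at (k : Z) : zpos (side_at k) = (k mod 5)%Z.
Proof.
  pose proof (Z.mod_pos_bound k 5 ltac:(lia)) as B. unfold side_at.
  assert (C : (k mod 5 = 0 \/ k mod 5 = 1 \/ k mod 5 = 2 \/ k mod 5 = 3
               \/ k mod 5 = 4)%Z) by lia.
  destruct C as [C|[C|[C|[C|C]]]]; rewrite C; reflexivity.
Qed.

Lemma src_corner (i : label) : src i = corner (zpos i).
Proof. apply corner_vertex. Qed.

Lemma tgt_corner (i : label) : tgt i = corner (zpos i + 1).
Proof.
  unfold tgt. rewrite corner_vertex, Nat2Z.inj_succ. reflexivity.
Qed.

Lemma src_side_at (k : Z) : src (side_at k) = corner k.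
Proof. rewrite src_corner, zpos_side_at. apply corner_mod. Qed.

Lemma tgt_side_at (k : Z) : tgt (side_at k) = corner (k + 1).
Proof.
  rewrite tgt_corner, zpos_side_at, <- corner_mod, Zplus_mod_idemp_l.
  apply corner_mod.
Qed.

Lemma edge_zeta (i : label) : edge i = zeta (zpos i).
Proof. unfold edge. rewrite src_corner, tgt_corner. apply corner_succ. Qed.

Lemma edge_conj_mul (i : label) : (edge i * Cconj (edge i))%C = RtoC 1.
Proof. rewrite edge_zeta. apply zeta_conj_mul. Qed.

Lemma tgt_src (i : label) : exists j, tgt i = src j.
Proof. exists (side_at (zpos i + 1)). rewrite src_side_at. apply tgt_corner. Qed.

Lemma open_side_on_line (i : label) (x : C) :
  open_side i x -> cross (edge i) (x - src i)%C = 0.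
Proof.
  intros (s & Hs & ->).
  replace ((RtoC (1 - s) * src i + RtoC s * tgt i - src i))%C
    with (RtoC s * edge i)%C.
  - rewrite cross_scal_r, cross_self. ring.
  - unfold edge. rewrite RtoC_minus. ring.
Qed.

(** With [d] the index shift from [j] to [i], the ends of side [i] have the heights
    of index [d] and [d + 1] over side [j], and one of these two indices lies
    between 2 and 4. *)
Lemma open_side_height (i j : label) (x : C) :
  open_side i x -> i <> j -> 0 < cross (edge j) (x - src j)%C.
Proof.
  intros (s & Hs & ->) N.
  set (d := ((zpos i - zpos j) mod 5)%Z).
  assert (B : (0 <= d < 5)%Z) by (apply Z.mod_pos_bound; lia).
  assert (N0 : d <> 0%Z).
  { intros Z0. apply N. unfold d in Z0.
    destruct i, j; try reflexivity; discriminate Z0. }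
  assert (Es : src i = corner (zpos j + d)).
  { unfold d. rewrite <- corner_mod, Zplus_mod_idemp_r, corner_mod, src_corner.
    f_equal. lia. }
  assert (Et : tgt i = corner (zpos j + (d + 1))).
  { rewrite tgt_corner, Z.add_assoc, <- (corner_mod (zpos j + d + 1)).
    unfold d. rewrite <- Zplus_mod_idemp_l, Zplus_mod_idemp_r, Zplus_mod_idemp_l.
    rewrite corner_mod. f_equal. lia. }
  replace (RtoC (1 - s) * src i + RtoC s * tgt i - src j)%C
    with (RtoC (1 - s) * (src i - src j) + RtoC s * (tgt i - src j))%C
    by (rewrite RtoC_minus; ring).
  rewrite cross_plus_r, !cross_scal_r, Es, Et, src_corner, edge_zeta.
  pose proof (height_nonneg (zpos j) d ltac:(lia)).
  pose proof (height_nonneg (zpos j) (d + 1) ltac:(lia)).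
  destruct (Z.eq_dec d 1) as [D|D].
  - pose proof (height_pos (zpos j) (d + 1) ltac:(lia)). nra.
  - pose proof (height_pos (zpos j) d ltac:(lia)). nra.
Qed.

Lemma label_eq_dec (i j : label) : {i = j} + {i <> j}.
Proof. decide equality. Qed.

(** A boundary point lies on one side only, so the side crossed by a trajectory is
    determined. *)
Lemma open_side_inj (i j : label) (x : C) :
  open_side i x -> open_side j x -> i = j.
Proof.
  intros Hi Hj. destruct (label_eq_dec i j) as [|N]; [assumption|].
  pose proof (open_side_height i j x Hi N).
  pose proof (open_side_on_line j x Hj). lra.
Qed.

Lemma open_side_inside (i j : label) (x : C) :
  open_side i x -> 0 <= cross (edge j) (x - src j)%C.
Proof.
  intros Hi. destruct (label_eq_dec i j) as [->|N].
  - rewrite open_side_on_line by exact Hi. lra.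
  - apply Rlt_le, (open_side_height i j x Hi N).
Qed.

(** * The axial symmetries of the pentagon *)

(** [reflect i] preserves the direction of side [i]; its opposite is the
    reflection in the axis perpendicular to side [i], which passes through the
    centre of the pentagon. *)
Definition axial (i : label) (z : C) : C := (- reflect i z)%C.

Lemma axial_plus (i : label) (y z : C) :
  axial i (y + z)%C = (axial i y + axial i z)%C.
Proof. unfold axial, reflect. rewrite Cplus_conj. ring. Qed.

Lemma axial_opp (i : label) (z : C) : axial i (- z)%C = (- axial i z)%C.
Proof. unfold axial, reflect. rewrite Copp_conj. ring. Qed.

Lemma axial_minus (i : label) (y z : C) :
  axial i (y - z)%C = (axial i y - axial i z)%C.
Proof. unfold Cminus. rewrite axial_plus, axial_opp. reflexivity. Qed.

Lemma Cconj_scal (r : R) (z : C) : Cconj (RtoC r * z)%C = (RtoC r * Cconj z)%C.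
Proof. apply injective_projections; simpl; ring. Qed.

Lemma axial_scal (i : label) (r : R) (z : C) :
  axial i (RtoC r * z)%C = (RtoC r * axial i z)%C.
Proof. unfold axial, reflect. rewrite Cconj_scal. ring. Qed.

Lemma axial_axial (i : label) (z : C) : axial i (axial i z) = z.
Proof.
  unfold axial, reflect.
  rewrite Copp_conj, !Cmult_conj, Cconj_conj.
  transitivity ((edge i * Cconj (edge i)) * (edge i * Cconj (edge i)) * z)%C;
    [ring|].
  rewrite edge_conj_mul. ring.
Qed.

Lemma cross_axial (i : label) (y z : C) :
  cross (axial i y) (axial i z) = - cross y z.
Proof.
  pose proof (edge_conj_mul i) as E. unfold axial, reflect.
  destruct (edge i) as [a b], y as [y1 y2], z as [z1 z2].
  injection E as E _. simpl in E.
  assert (E2 : a * a + b * b = 1) by lra.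
  unfold cross, Re, Im; simpl.
  transitivity (- ((a * a + b * b) * (a * a + b * b)) * (y1 * z2 - y2 * z1));
    [ring|].
  rewrite E2. ring.
Qed.

(** The axis of [axial i] passes through the midpoint of side [i], whose ends have
    indices of sum [2 * zpos i + 1]. *)
Lemma axial_corner (i : label) (k : Z) :
  axial i (corner k) = corner (2 * zpos i + 1 - k).
Proof.
  unfold axial, reflect. rewrite edge_zeta.
  unfold corner. rewrite Cconj_scal, unit_dir_conj.
  transitivity (RtoC (/ (2 * sin (PI / 5))) *
    (zeta (zpos i) * zeta (zpos i)
     * unit_dir (- (- (7 * PI / 10) + IZR k * (2 * PI / 5))) * unit_dir PI))%C.
  { rewrite unit_dir_PI. ring. }
  f_equal. unfold zeta. rewrite <- !unit_dir_add.
  (* The angles -54deg and 306deg differ by the full turn [zeta 5]. *)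
  transitivity (unit_dir (- (7 * PI / 10) + IZR (2 * zpos i + 1 - k) * (2 * PI / 5))
                * zeta 5)%C.
  - unfold zeta. rewrite <- unit_dir_add. f_equal.
    rewrite minus_IZR, plus_IZR, mult_IZR. field.
  - rewrite zeta_5. ring.
Qed.

(** The action of [axial i] on the sides.  The axial symmetry reverses the
    boundary, so the source [zpos j] goes to the target of the image side. *)
Definition mirror (i j : label) : label := side_at (2 * zpos i - zpos j).

Lemma mirror_mirror (i j : label) : mirror i (mirror i j) = j.
Proof. destruct i, j; reflexivity. Qed.

Lemma axial_src (i j : label) : axial i (src j) = tgt (mirror i j).
Proof.
  unfold mirror. rewrite src_corner, axial_corner, tgt_side_at. f_equal. lia.
Qed.

Lemma axial_tgt (i j : label) : axial i (tgt j) = src (mirror i j).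
Proof.
  unfold mirror. rewrite tgt_corner, axial_corner, src_side_at. f_equal. lia.
Qed.

Lemma axial_edge (i j : label) : axial i (edge j) = (- edge (mirror i j))%C.
Proof.
  unfold edge. rewrite axial_minus, axial_src, axial_tgt. ring.
Qed.

Lemma mirror_self (i : label) : mirror i i = i.
Proof. destruct i; reflexivity. Qed.

(** [axial i] changes the sign of [cross] and also the orientation of the
    sides, so the half-planes bounding the pentagon are permuted. *)
Lemma pentagon_axial (i : label) (z : C) : pentagon z -> pentagon (axial i z).
Proof.
  intros H j. split.
  - destruct (H (mirror i j)) as [Hc _].
    set (m := mirror i j) in *.
    assert (Ej : j = mirror i m) by (symmetry; apply mirror_mirror).
    replace (edge j) with (axial i (- edge m))%C
      by (rewrite axial_opp, axial_edge, <- Ej; ring).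
    replace (src j) with (axial i (tgt m)) by (rewrite axial_tgt, <- Ej; reflexivity).
    rewrite <- axial_minus, cross_axial.
    (* [src m] and [tgt m] lie on the same line, so either one may be the origin
       in measuring the height over side [m]. *)
    replace (z - tgt m)%C with (z - src m - edge m)%C by (unfold edge; ring).
    rewrite cross_minus_r. revert Hc. unfold cross, Re, Im; simpl; lra.
  - intros E.
    destruct (tgt_src (mirror i j)) as [k Hk].
    destruct (H k) as [_ Hn]. apply Hn.
    rewrite <- Hk, <- axial_src, <- E, axial_axial. reflexivity.
Qed.

Lemma open_side_axial (i j : label) (z : C) :
  open_side j z -> open_side (mirror i j) (axial i z).
Proof.
  intros (s & Hs & ->). exists (1 - s). split; [lra|].
  rewrite axial_plus, !axial_scal, axial_src, axial_tgt.
  replace (1 - (1 - s)) with s by ring. ring.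
Qed.

Lemma outward_axial (i j : label) (v : C) :
  outward j v -> outward (mirror i j) (axial i v).
Proof.
  unfold outward. intros H.
  replace (edge (mirror i j)) with (axial i (- edge j))%C
    by (rewrite axial_opp, axial_edge; ring).
  rewrite cross_axial. revert H. unfold cross, Re, Im; simpl. lra.
Qed.

(** An isometry conjugates the reflection in a line to the reflection in the image
    of this line. *)
Lemma reflect_axial (i j : label) (v : C) :
  reflect (mirror i j) (axial i v) = axial i (reflect j v).
Proof.
  unfold reflect at 1.
  replace (edge (mirror i j)) with (axial i (- edge j))%C
    by (rewrite axial_opp, axial_edge; ring).
  unfold axial, reflect.
  repeat rewrite ?Copp_conj, ?Cmult_conj, ?Cconj_conj.
  transitivity ((edge i * edge i)
    * ((edge i * Cconj (edge i)) * (edge i * Cconj (edge i))) * Cconj (edge j) * Cconj (edge j) * - v)%C; [ring|].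
  rewrite edge_conj_mul. ring.
Qed.

(** * Folding words

    The letters of a word are the sides crossed on the surface.  The last letter
    acts first, so that a letter appended to the word is an inner symmetry:
    the sides of the surface are renamed by the symmetry accumulated before. *)
Fixpoint unfold_map (w : list label) (z : C) : C :=
  match w with nil => z | i :: w' => axial i (unfold_map w' z) end.

Fixpoint unfold_side (w : list label) (j : label) : label :=
  match w with nil => j | i :: w' => mirror i (unfold_side w' j) end.

Lemma unfold_map_app (w w' : list label) (z : C) :
  unfold_map (w ++ w') z = unfold_map w (unfold_map w' z).
Proof. induction w as [|i w IH]; simpl; [|rewrite IH]; reflexivity. Qed.

Lemma unfold_map_plus (w : list label) (y z : C) :
  unfold_map w (y + z)%C = (unfold_map w y + unfold_map w z)%C.
Proof. induction w as [|i w IH]; simpl; [|rewrite IH, axial_plus]; reflexivity. Qed.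

Lemma unfold_map_scal (w : list label) (r : R) (z : C) :
  unfold_map w (RtoC r * z)%C = (RtoC r * unfold_map w z)%C.
Proof. induction w as [|i w IH]; simpl; [|rewrite IH, axial_scal]; reflexivity. Qed.

Lemma unfold_side_onto (w : list label) (j : label) : exists i, j = unfold_side w i.
Proof.
  revert j. induction w as [|k w IH]; intros j; simpl.
  - now exists j.
  - destruct (IH (mirror k j)) as [i Hi]. exists i.
    rewrite <- Hi, mirror_mirror. reflexivity.
Qed.

Lemma pentagon_unfold (w : list label) (z : C) :
  pentagon (unfold_map w z) <-> pentagon z.
Proof.
  induction w as [|i w IH]; simpl; [tauto|]. rewrite <- IH. split.
  - intros H. rewrite <- (axial_axial i). now apply pentagon_axial.
  - apply pentagon_axial.
Qed.

Lemma open_side_unfold (w : list label) (j : label) (z : C) :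
  open_side (unfold_side w j) (unfold_map w z) <-> open_side j z.
Proof.
  induction w as [|i w IH]; simpl; [tauto|]. rewrite <- IH. split.
  - intros H. apply (open_side_axial i) in H.
    rewrite mirror_mirror, axial_axial in H. exact H.
  - apply open_side_axial.
Qed.

Lemma outward_unfold (w : list label) (j : label) (v : C) :
  outward (unfold_side w j) (unfold_map w v) <-> outward j v.
Proof.
  induction w as [|i w IH]; simpl; [tauto|]. rewrite <- IH. split.
  - intros H. apply (outward_axial i) in H.
    rewrite mirror_mirror, axial_axial in H. exact H.
  - apply outward_axial.
Qed.

Lemma reflect_unfold (w : list label) (j : label) (v : C) :
  reflect (unfold_side w j) (unfold_map w v) = unfold_map w (reflect j v).
Proof.
  induction w as [|i w IH]; simpl; [reflexivity|].
  rewrite reflect_axial, IH. reflexivity.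
Qed.

(** * The flow on the double pentagon and the billiard *)
Lemma flip_other (s : sheet) (z : C) : flip (other s) z = (- flip s z)%C.
Proof. destruct s; simpl; [reflexivity|ring]. Qed.

Lemma flip_move (s : sheet) (x v : C) (t : R) :
  flip s (x + RtoC t * v)%C = (flip s x + RtoC t * flip s v)%C.
Proof. destruct s; simpl; [reflexivity|ring]. Qed.

Lemma flip_glue (s : sheet) (i : label) (x : C) :
  flip (other s) (glue s i x) = (src i + tgt i - flip s x)%C.
Proof. destruct s; simpl; ring. Qed.

(** Brought back to P, the gluing is the point reflection in the midpoint of side
    [i]; on that side [axial i] is this same reflection, and undoes it. *)
Lemma axial_glue (s : sheet) (i : label) (x : C) :
  open_side i (flip s x) -> axial i (flip (other s) (glue s i x)) = flip s x.
Proof.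
  rewrite flip_glue. intros (r & Hr & ->).
  rewrite axial_minus, !axial_plus, !axial_scal, axial_src, axial_tgt, mirror_self.
  rewrite RtoC_minus. ring.
Qed.

(** The other sheet sees the opposite velocity, and [- axial i] is [reflect i]. *)
Lemma axial_flip_other (s : sheet) (i : label) (v : C) :
  axial i (flip (other s) v) = reflect i (flip s v).
Proof. rewrite flip_other, axial_opp. unfold axial. ring. Qed.

(** The symmetry [u] accumulated before the start is arbitrary, because each
    crossing appends one letter to it. *)
Lemma flow_billiard (v : C) (p q : sheet * C) (t : R) (w : list label) :
  flow v p t w q -> forall u,
  billiard (unfold_map u (flip (fst p) (snd p)), unfold_map u (flip (fst p) v))
    t (length w)
    (unfold_map (u ++ w) (flip (fst q) (snd q)),
     unfold_map (u ++ w) (flip (fst q) v)).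
Proof.
  induction 1 as [s x t Ht Hx Hy | s x t i t' w q Ht Hx Hy Ho Hf IH]; intros u; simpl.
  - rewrite app_nil_r. rewrite flip_move, unfold_map_plus, unfold_map_scal.
    constructor; [exact Ht | now apply pentagon_unfold |].
    rewrite <- unfold_map_scal, <- unfold_map_plus, <- flip_move.
    now apply pentagon_unfold.
  - assert (E : (unfold_map u (flip s x) + RtoC t * unfold_map u (flip s v))%C
                = unfold_map u (flip s (x + RtoC t * v)%C))
      by (now rewrite flip_move, unfold_map_plus, unfold_map_scal).
    apply billiard_bounce with (i := unfold_side u i).
    + exact Ht.
    + now apply pentagon_unfold.
    + rewrite E. now apply open_side_unfold.
    + now apply outward_unfold.
    + rewrite E, reflect_unfold.
      specialize (IH (u ++ [i])). cbn [fst snd] in IH.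
      rewrite <- app_assoc, !(unfold_map_app u [i]) in IH. simpl in IH.
      rewrite axial_glue, axial_flip_other in IH by exact Hy.
      exact IH.
Qed.

Lemma billiard_flow (v : C) (a b : C * C) (t : R) (n : nat) :
  billiard a t n b -> forall u s x,
  a = (unfold_map u (flip s x), unfold_map u (flip s v)) ->
  exists w s' x', length w = n /\ flow v (s, x) t w (s', x') /\
    b = (unfold_map (u ++ w) (flip s' x'), unfold_map (u ++ w) (flip s' v)).
Proof.
  induction 1 as [y c t Ht Hy Hz | y c t j t' n q Ht Hy Hz Ho Hb IH];
    intros u s x E; injection E as -> ->.
  - rewrite <- unfold_map_scal, <- unfold_map_plus, <- flip_move in Hz |- *.
    exists nil, s, (x + RtoC t * v)%C. rewrite app_nil_r.
    repeat split. constructor; [exact Ht | now apply pentagon_unfold in Hy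
                                | now apply pentagon_unfold in Hz].
  - rewrite <- unfold_map_scal, <- unfold_map_plus, <- flip_move in Hz, IH.
    destruct (unfold_side_onto u j) as [i ->].
    apply open_side_unfold in Hz. apply outward_unfold in Ho.
    apply pentagon_unfold in Hy.
    destruct (IH (u ++ [i]) (other s) (glue s i (x + RtoC t * v)%C))
      as (w & s' & x' & Hl & Hf & ->).
    { rewrite !(unfold_map_app u [i]). simpl.
      rewrite axial_glue, axial_flip_other, reflect_unfold by exact Hz. reflexivity. }
    exists (i :: w), s', x'. repeat split.
    + simpl. now rewrite Hl.
    + now apply flow_cross.
    + rewrite <- app_assoc. reflexivity.
Qed.

(** * Determinism of the flow *)
Lemma flow_sheet (v : C) (p q : sheet * C) (t : R) (w : list label) :
  flow v p t w q -> fst q = if Nat.even (length w) then fst p else other (fst p).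
Proof.
  induction 1 as [|s x t i t' w q Ht Hx Hy Ho Hf IH]; [reflexivity|].
  rewrite IH. cbn [length fst]. rewrite Nat.even_succ, <- Nat.negb_even.
  destruct (Nat.even (length w)), s; reflexivity.
Qed.

Lemma flow_pentagon_start (v : C) (p q : sheet * C) (t : R) (w : list label) :
  flow v p t w q -> pentagon (flip (fst p) (snd p)).
Proof. destruct 1; assumption. Qed.

Lemma flow_time_nonneg (v : C) (p q : sheet * C) (t : R) (w : list label) :
  flow v p t w q -> 0 <= t.
Proof. induction 1; lra. Qed.

Lemma flow_app (v : C) (p q r : sheet * C) (t t' : R) (w w' : list label) :
  flow v p t w q -> flow v q t' w' r -> flow v p (t + t') (w ++ w') r.
Proof.
  induction 1 as [s x t Ht Hx Hy | s x t i t1 w q Ht Hx Hy Ho Hf IH]; intros H.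
  - remember (s, (x + RtoC t * v)%C) as q eqn:E.
    assert (A : forall t1, (x + RtoC t * v + RtoC t1 * v = x + RtoC (t + t1) * v)%C)
      by (intros; rewrite RtoC_plus; ring).
    destruct H as [s' y t' Ht' Hy' Hz' | s' y t1 i t' w q' Ht' Hy' Hz' Ho' Hf'];
      injection E as -> ->; simpl; rewrite A in *.
    + constructor; [lra | assumption | assumption].
    + rewrite <- Rplus_assoc. now apply flow_cross; [lra | ..].
  - simpl. rewrite Rplus_assoc. apply flow_cross; auto.
Qed.

(** The signed distance to the line of side [i] vanishes at time [t] and decreases
    along an outward velocity. *)
Lemma exit_time_max (s : sheet) (x v : C) (i : label) (t t' : R) :
  open_side i (flip s (x + RtoC t * v)%C) -> outward i (flip s v) ->
  0 <= cross (edge i) (flip s (x + RtoC t' * v) - src i)%C -> t' <= t.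
Proof.
  intros Hs Ho Hc.
  apply open_side_on_line in Hs. unfold outward in Ho.
  rewrite flip_move, cross_minus_r, cross_plus_r, cross_scal_r in Hs, Hc.
  nra.
Qed.

Lemma move_add (x v : C) (t t' : R) :
  (x + RtoC t * v + RtoC t' * v = x + RtoC (t + t') * v)%C.
Proof. rewrite RtoC_plus. ring. Qed.

(** Determinism.  At the instant of a crossing two states, on the two
    glued sides, are reached at the same time; so [t1 <= t2] does not tell which of
    the two runs extends the other, and the conclusion is symmetric. *)
Lemma flow_comparable (v : C) (p q1 q2 : sheet * C) (t1 t2 : R) (w1 w2 : list label) :
  flow v p t1 w1 q1 -> flow v p t2 w2 q2 ->
  (exists w, w2 = w1 ++ w /\ flow v q1 (t2 - t1) w q2) \/
  (exists w, w1 = w2 ++ w /\ flow v q2 (t1 - t2) w q1).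
Proof.
  intros F1. revert t2 w2 q2.
  induction F1 as [s x t Ht Hx Hy | s x t i t' w q Ht Hx Hy Ho Hf IH];
    intros t2 w2 q2 F2.
  - remember (s, x) as p eqn:E.
    destruct F2 as [s2 x2 t2 Ht2 Hx2 Hy2 | s2 x2 t2 i2 t2' w2 q2 Ht2 Hx2 Hy2 Ho2 Hf2];
      injection E as -> ->.
    + destruct (Rle_dec t t2) as [L | L]; [left | right]; exists nil;
        (split; [reflexivity|]).
      * replace (x + RtoC t2 * v)%C with (x + RtoC t * v + RtoC (t2 - t) * v)%C
          by (rewrite move_add; do 3 f_equal; ring).
        constructor; [lra | exact Hy |].
        rewrite move_add. replace (t + (t2 - t)) with t2 by ring. exact Hy2.
      * replace (x + RtoC t * v)%C with (x + RtoC t2 * v + RtoC (t - t2) * v)%C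
          by (rewrite move_add; do 3 f_equal; ring).
        constructor; [lra | exact Hy2 |].
        rewrite move_add. replace (t2 + (t - t2)) with t by ring. exact Hy.
    + left. exists (i2 :: w2). split; [reflexivity|].
      pose proof (exit_time_max _ _ _ _ _ _ Hy2 Ho2 (proj1 (Hy i2))) as L.
      assert (M : (x + RtoC t * v + RtoC (t2 - t) * v)%C = (x + RtoC t2 * v)%C)
        by (rewrite move_add; do 3 f_equal; ring).
      replace (t2 + t2' - t) with ((t2 - t) + t2') by ring.
      apply flow_cross; rewrite ?M; [lra | assumption ..].
  - remember (s, x) as p eqn:E.
    destruct F2 as [s2 x2 t2 Ht2 Hx2 Hy2 | s2 x2 t2 i2 t2' w2 q2 Ht2 Hx2 Hy2 Ho2 Hf2];
      injection E as -> ->.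
    + right. exists (i :: w). split; [reflexivity|].
      pose proof (exit_time_max _ _ _ _ _ _ Hy Ho (proj1 (Hy2 i))) as L.
      assert (M : (x + RtoC t2 * v + RtoC (t - t2) * v)%C = (x + RtoC t * v)%C)
        by (rewrite move_add; do 3 f_equal; ring).
      replace (t + t' - t2) with ((t - t2) + t') by ring.
      apply flow_cross; rewrite ?M; [lra | assumption ..].
    + pose proof (exit_time_max _ _ _ _ _ _ Hy Ho (open_side_inside _ i _ Hy2)) as La.
      pose proof (exit_time_max _ _ _ _ _ _ Hy2 Ho2 (open_side_inside _ i2 _ Hy)) as Lb.
      assert (t2 = t) as -> by lra.
      rewrite (open_side_inj _ _ _ Hy2 Hy) in *.
      destruct (IH _ _ _ Hf2) as [(u & -> & Hu) | (u & -> & Hu)]; [left | right];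
        exists u; (split; [reflexivity|]).
      * replace (t + t2' - (t + t')) with (t2' - t') by ring. exact Hu.
      * replace (t + t' - (t + t2')) with (t' - t2') by ring. exact Hu.
Qed.

(** After crossing a side the velocity points into the new sheet, so without
    moving there is no second crossing, and a single one changes the sheet. *)
Lemma flow_zero_loop (v : C) (p : sheet * C) (w : list label) :
  flow v p 0 w p -> w = nil.
Proof.
  intros F. remember 0 as t eqn:Et. remember p as q eqn:Eq in F at 2.
  destruct F as [s x t Ht Hx Hy | s x t i t' w q Ht Hx Hy Ho Hf]; [reflexivity|].
  exfalso. pose proof (flow_time_nonneg _ _ _ _ _ Hf).
  assert (t = 0) as -> by lra. assert (t' = 0) as -> by lra.
  remember (other s, glue s i (x + RtoC 0 * v)%C) as r eqn:Er.
  remember 0 as t' eqn:Et' in Hf.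
  destruct Hf as [s1 y t1 _ _ _ | s1 y t1 j t2 w q H1 _ Hz Ho1 Hf1].
  - injection Er as -> ->. injection Eq as E _. destruct s; discriminate E.
  - injection Er as -> ->. pose proof (flow_time_nonneg _ _ _ _ _ Hf1).
    assert (t1 = 0) as -> by lra.
    (* If a second side [j] is crossed at once, pulling it back by [axial i] to the
       first sheet shows that it is side [i] again, where [v] points inward. *)
    assert (Hj : open_side (mirror i j) (axial i (flip (other s)
              (glue s i (x + RtoC 0 * v) + RtoC 0 * v)%C)))
      by now apply open_side_axial.
    replace (glue s i (x + RtoC 0 * v) + RtoC 0 * v)%C
      with (glue s i (x + RtoC 0 * v)%C) in Hj by ring.
    rewrite axial_glue in Hj by exact Hy.
    pose proof (open_side_inj _ _ _ Hj Hy) as E.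
    assert (j = i) as -> by (rewrite <- (mirror_mirror i j), E; apply mirror_self).
    unfold outward in *. rewrite flip_other in Ho1.
    revert Ho Ho1. unfold cross, Re, Im; simpl. lra.
Qed.

(** * The alternating sum of a word *)
Fixpoint alt_sum (w : list label) : Z :=
  match w with nil => 0 | i :: w' => zpos i - alt_sum w' end%Z.

Lemma alt_sum_app (w w' : list label) :
  (alt_sum (w ++ w')
   = alt_sum w + (if Nat.even (length w) then alt_sum w' else - alt_sum w'))%Z.
Proof.
  induction w as [|i w IH]; [reflexivity|].
  cbn [app length alt_sum]. rewrite IH, Nat.even_succ, <- Nat.negb_even.
  destruct (Nat.even (length w)); simpl; lia.
Qed.

Lemma alt_sum_rev (w : list label) :
  alt_sum (rev w) = (if Nat.even (length w) then - alt_sum w else alt_sum w)%Z.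
Proof.
  induction w as [|i w IH]; [reflexivity|].
  cbn [rev]. rewrite alt_sum_app, IH, length_rev.
  cbn [length alt_sum]. rewrite Nat.even_succ, <- Nat.negb_even.
  destruct (Nat.even (length w)); simpl; lia.
Qed.

(** [axial i] is [z |-> - zeta (2 * zpos i) * Cconj z], and the conjugation turns the
    exponent collected so far into its opposite: hence the alternating sum. *)
Lemma unfold_map_rotation (w : list label) (z : C) :
  unfold_map w z = (zeta (2 * alt_sum w) *
                    if Nat.even (length w) then z else - Cconj z)%C.
Proof.
  induction w as [|i w IH].
  - simpl. rewrite zeta_0. ring.
  - cbn [unfold_map length alt_sum]. rewrite IH, Nat.even_succ, <- Nat.negb_even.
    unfold axial, reflect. rewrite edge_zeta.
    replace (2 * (zpos i - alt_sum w))%Z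
      with (zpos i + (zpos i + - (2 * alt_sum w)))%Z by lia.
    rewrite !zeta_add, <- zeta_opp, Cmult_conj.
    destruct (Nat.even (length w)); simpl; [|rewrite Copp_conj, Cconj_conj]; ring.
Qed.

Lemma unfold_map_fix (w : list label) (v : C) :
  Nat.even (length w) = true -> v <> RtoC 0 ->
  unfold_map w v = v <-> (alt_sum w mod 5 = 0)%Z.
Proof.
  intros Ev N. rewrite unfold_map_rotation, Ev. split.
  - intros E.
    assert (E1 : zeta (2 * alt_sum w) = RtoC 1).
    { transitivity (zeta (2 * alt_sum w) * v * / v)%C; [|rewrite E]; now field. }
    apply zeta_eq_1 in E1. Z.div_mod_to_equations. lia.
  - intros E. rewrite <- zeta_mod, Zmult_mod, E. simpl.
    change (0 mod 5)%Z with 0%Z. rewrite zeta_0. ring.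
Qed.

Lemma unfold_map_trivial (w : list label) (z : C) :
  Nat.even (length w) = true -> (alt_sum w mod 5 = 0)%Z -> unfold_map w z = z.
Proof.
  intros Ev E. rewrite unfold_map_rotation, Ev, <- zeta_mod, Zmult_mod, E.
  change ((2 mod 5 * 0) mod 5)%Z with 0%Z. rewrite zeta_0. ring.
Qed.

(** * Returns of the flow and of the billiard *)
Fixpoint word_pow (m : nat) (w : list label) : list label :=
  match m with O => nil | S m' => w ++ word_pow m' w end.

Lemma alt_sum_pow (m : nat) (w : list label) :
  Nat.even (length w) = true ->
  alt_sum (word_pow m w) = (Z.of_nat m * alt_sum w)%Z.
Proof.
  intros E. induction m as [|m IH]; [reflexivity|].
  cbn [word_pow]. rewrite alt_sum_app, E, IH. lia.
Qed.

Lemma flow_pow (v : C) (p : sheet * C) (L : R) (w : list label) (m : nat) :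
  flow v p L w p -> flow v p (INR m * L) (word_pow m w) p.
Proof.
  intros F. induction m as [|m IH].
  - destruct p as [s x]. pose proof (flow_pentagon_start _ _ _ _ _ F) as Hx.
    cbn [fst snd] in Hx. simpl. rewrite Rmult_0_l.
    replace x with (x + RtoC 0 * v)%C at 2 by ring.
    constructor; [lra | exact Hx |].
    replace (x + RtoC 0 * v)%C with x by ring. exact Hx.
  - rewrite S_INR. replace ((INR m + 1) * L) with (L + INR m * L) by ring.
    simpl. now apply flow_app with p.
Qed.

(** Removing the first traversal from a return of length [T > L] leaves a return
    of length [T - L]; the Archimedean property ends this descent. *)
Lemma closed_flow_multiple (v : C) (p : sheet * C) (L T : R) (w u : list label) :
  closed_trajectory v p L w -> 0 < T -> flow v p T u p ->
  exists m : nat, T = INR m * L /\ u = word_pow m w.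
Proof.
  intros (HL & F & Hmin) HT FT.
  destruct (archimed (T / L)) as [A _].
  set (N := up (T / L)) in A.
  assert (B : T <= INR (Z.to_nat N) * L).
  { assert (0 < T / L) by now apply Rdiv_lt_0_compat.
    assert (0 < IZR N) by lra. apply lt_IZR in H0.
    rewrite INR_IZR_INZ, Z2Nat.id by lia.
    apply Rmult_le_reg_r with (/ L); [now apply Rinv_0_lt_compat|].
    field_simplify; lra. }
  clearbody N. clear A. revert T u HT FT B.
  induction (Z.to_nat N) as [|n IH]; intros T u HT FT B.
  - simpl in B. lra.
  - rewrite S_INR in B. pose proof (Hmin T u HT FT) as HLT.
    destruct (flow_comparable _ _ _ _ _ _ _ _ F FT)
      as [(r & -> & Fr) | (r & -> & Fr)].
    + destruct (Req_dec T L) as [->|Ne].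
      * rewrite Rminus_diag_eq in Fr by reflexivity.
        apply flow_zero_loop in Fr. subst r.
        exists 1%nat. simpl. split; [ring | reflexivity].
      * destruct (IH (T - L) r) as (m & Hm & ->); [lra | exact Fr | lra |].
        exists (S m). rewrite S_INR. split; [lra | reflexivity].
    + pose proof (flow_time_nonneg _ _ _ _ _ Fr).
      assert (T = L) as -> by lra.
      rewrite Rminus_diag_eq in Fr by reflexivity.
      apply flow_zero_loop in Fr. subst r. rewrite app_nil_r.
      exists 1%nat. simpl. rewrite app_nil_r. split; [ring | reflexivity].
Qed.

(** Parity of the number of reflections is what sends the sheet P back to itself;
    the return of the velocity then forces the folding rotation to be trivial,
    so the position on the surface returns as well. *)
Lemma billiard_return_flow (v x : C) (T : R) :
  v <> RtoC 0 ->
  billiard_return x v T <->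
  0 < T /\ exists u, flow v (SheetP, x) T u (SheetP, x) /\ (alt_sum u mod 5 = 0)%Z.
Proof.
  intros Nv. split.
  - intros (HT & n & Hn & Hb). split; [exact HT|].
    destruct (billiard_flow v _ _ _ _ Hb nil SheetP x eq_refl)
      as (u & s & y & Hl & Hf & E).
    apply Nat.even_spec in Hn. rewrite <- Hl in Hn.
    pose proof (flow_sheet _ _ _ _ _ Hf) as Hs. rewrite Hn in Hs.
    cbn [fst] in Hs. subst s. injection E as Ex Ev. simpl in Ex, Ev.
    assert (Ha : (alt_sum u mod 5 = 0)%Z)
      by (apply (unfold_map_fix u v Hn Nv); congruence).
    rewrite unfold_map_trivial in Ex by assumption. subst y.
    now exists u.
  - intros (HT & u & Hf & Ha). split; [exact HT|]. exists (length u).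
    pose proof (flow_sheet _ _ _ _ _ Hf) as Hs. cbn [fst] in Hs.
    assert (Ev : Nat.even (length u) = true)
      by (destruct (Nat.even (length u)); [reflexivity | discriminate Hs]).
    split; [now apply Nat.even_spec|].
    pose proof (flow_billiard _ _ _ _ _ Hf nil) as Hb. simpl in Hb.
    now rewrite !unfold_map_trivial in Hb by assumption.
Qed.

(** * The Roman symbolic orbit *)

(** Blocks have even length, so their alternating sums simply add up. *)
Lemma alt_sum_roman (rho : list roman) :
  Nat.even (length (flat_map block rho)) = true /\
  alt_sum (flat_map block rho)
  = (3 * nb RI rho - nb RII rho + nb RIII rho + 2 * nb RIV rho)%Z.
Proof.
  unfold nb. induction rho as [|a rho [IHe IH]]; [split; reflexivity|].
  cbn [flat_map]. rewrite length_app, Nat.even_add, alt_sum_app, IHe, IH.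
  destruct a; split; try reflexivity;
    cbn -[Z.of_nat Z.mul Z.sub Z.add Z.opp];
    rewrite ?Nat2Z.inj_succ; unfold zpos; simpl Defs.pos; lia.
Qed.

(** In a cyclic word of even length moving the starting letter by one step
    exchanges the two signs. *)
Lemma alt_sum_cyclic (u w : list label) :
  Nat.even (length u) = true -> cyclic_perm u w ->
  alt_sum w = alt_sum u \/ alt_sum w = (- alt_sum u)%Z.
Proof.
  intros E (w1 & w2 & -> & ->).
  rewrite length_app, Nat.even_add in E. rewrite !alt_sum_app.
  destruct (Nat.even (length w1)), (Nat.even (length w2)); try discriminate E; lia.
Qed.

(** Since 2 is invertible mod 5, the alternating sum may be doubled, which turns
    its coefficients 3, -1, 1, 2 into 1, -2, 2, -1. *)
Lemma alt_sum_roman_orbit (v : C) (w : list label) (rho : list roman) :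
  roman_orbit v w rho ->
  (alt_sum w mod 5 = 0)%Z <->
  (((nb RI rho - nb RIV rho) + 2 * (nb RIII rho - nb RII rho)) mod 5 = 0)%Z.
Proof.
  unfold roman_orbit. intros H.
  destruct (alt_sum_roman rho) as [Ev Es].
  apply alt_sum_cyclic in H; [|exact Ev].
  assert (A : alt_sum w = alt_sum (flat_map block rho)
              \/ alt_sum w = (- alt_sum (flat_map block rho))%Z).
  { unfold upward_word in H. destruct (Rlt_dec 0 (Im v)); [exact H|].
    rewrite alt_sum_rev in H. destruct (Nat.even (length w)); lia. }
  rewrite Es in A. clear -A. Z.div_mod_to_equations. lia.
Qed.

Lemma sector3_neq_0 (v : C) : in_sector3 v -> v <> RtoC 0.
Proof.
  intros (theta & _ & [-> | ->]) E; apply (unit_dir_neq_0 theta); [exact E|].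
  replace (unit_dir theta) with (- - unit_dir theta)%C by ring. rewrite E. ring.
Qed.

Theorem theorem11
    (v : C) (x : C) (L : R) (w : list label) (rho : list roman) (c d e f : Z)
    (hv : in_sector3 v)
    (hL : closed_trajectory v (SheetP, x) L w)
    (hrho : roman_orbit v w rho)
    (hc : c = nb RI rho) (hd : d = nb RII rho)
    (he : e = nb RIII rho) (hf : f = nb RIV rho) :
    billiard_periodic x v /\
    billiard_length x v
      (if (((c - f) + 2 * (e - d)) mod 5 =? 0)%Z then L else 5 * L).
Proof.
  subst c d e f.
  apply sector3_neq_0 in hv.
  apply alt_sum_roman_orbit in hrho.
  pose proof hL as (HL & F & _).
  match goal with |- _ /\ billiard_length _ _ ?T' => set (T := T') end.
  enough (billiard_length x v T) as H by (split; [exists T; apply H | exact H]).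
  assert (Ev : Nat.even (length w) = true).
  { pose proof (flow_sheet _ _ _ _ _ F) as Hs.
    destruct (Nat.even (length w)); [reflexivity | discriminate Hs]. }
  (* [m] is the order of the folding rotation of [w]. *)
  assert (Hm : exists m : nat, T = INR m * L /\ (0 < m)%nat /\
    (alt_sum (word_pow m w) mod 5 = 0)%Z /\
    forall k : nat, (0 < k)%nat -> (alt_sum (word_pow k w) mod 5 = 0)%Z -> (m <= k)%nat).
  { unfold T. destruct (Z.eqb_spec
      ((nb RI rho - nb RIV rho + 2 * (nb RIII rho - nb RII rho)) mod 5) 0) as [E|E];
      rewrite <- hrho in E.
    - exists 1%nat. rewrite alt_sum_pow, Z.mul_1_l by exact Ev.
      repeat split; [simpl; ring | lia | exact E | lia].
    - exists 5%nat. rewrite alt_sum_pow by exact Ev.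
      repeat split; [simpl; ring | lia | |].
      + change (Z.of_nat 5) with 5%Z. rewrite Z.mul_comm. apply Z.mod_mul. lia.
      + intros k Hk. rewrite alt_sum_pow by exact Ev. intros Ek.
        destruct (Nat.le_gt_cases 5 k) as [|Hk5]; [assumption|exfalso].
        clear -E Ek Hk Hk5.
        assert (C : (k = 1 \/ k = 2 \/ k = 3 \/ k = 4)%nat) by lia.
        destruct C as [-> | [-> | [-> | ->]]]; simpl Z.of_nat in Ek;
          Z.div_mod_to_equations; lia. }
  destruct Hm as (m & -> & Hm0 & Hm & Hmin).
  split.
  - apply billiard_return_flow; [exact hv|]. split.
    + apply Rmult_lt_0_compat; [now apply lt_0_INR | exact HL].
    + exists (word_pow m w). split; [now apply flow_pow | exact Hm].
  - intros T' HT. apply billiard_return_flow in HT; [|exact hv].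
    destruct HT as (HT & u & Fu & Hu).
    destruct (closed_flow_multiple _ _ _ _ _ _ hL HT Fu) as (k & -> & ->).
    apply Rmult_le_compat_r; [lra|]. apply le_INR, Hmin; [|exact Hu].
    destruct k; [simpl in HT; lra | lia].
Qed.
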